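(* Let $f:A\to B$ be a homomorphism of commutative rings with unity, let $J$ be an ideal of $B$, and let $A\bowtie^f J=\{(a,f(a)+j)\mid a\in A,\ j\in J\}\subseteq A\times B$. For $P\in \mathrm{Spec}(A)$ and $Q\in\mathrm{Spec}(B)$ set $P^{\prime_f}:=\{(p,f(p)+j)\mid p\in P,\ j\in J\}$ and $\overline{Q}^{f}:=\{(a,f(a)+j)\mid a\in A,\ j\in J,\ f(a)+j\in Q\}$. Then: (1) Let $P\in\mathrm{Spec}(A)$. Then $P^{\prime_f}$ is a maximal ideal of $A\bowtie^f J$ if and only if $P$ is a maximal ideal of $A$. (2) Let $Q$ be a prime ideal of $B$ not containing $J$. Then $\overline{Q}^f$ is a maximal ideal of $A\bowtie^f J$ if and only if $Q$ is a maximal ideal of $B$. In particular, $$\mathrm{Max}(A\bowtie^f J)=\{P^{\prime_f}\mid P\in\mathrm{Max}(A)\}\cup\{\overline{Q}^f\mid Q\in\mathrm{Max}(B)\setminus V(J)\}.$$ (3) $A\bowtie^f J$ is a local ring if and only if $A$ is a local ring and $J\subseteq\mathrm{Jac}(B)$. In particular, in that case, if $M$ is the unique maximal ideal of $A$, then $M^{\prime_f}=\{(m,f(m)+j)\mid m\in M,\ j\in J\}$ is the unique maximal ideal of $A\bowtie^f J$.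
   Context: $A\bowtie^f J$ is a subring of $A\times B$ (the amalgamation of $A$ with $B$ along $J$ with respect to $f$). $\mathrm{Max}(R)$ is the set of maximal ideals of $R$, $\mathrm{Jac}(R)$ the Jacobson radical of $R$, and $V(J)$ the set of prime ideals of $B$ containing $J$. ''Local'' means having exactly one maximal ideal (not necessarily Noetherian). *)

(* Defs.v *)
From HB Require Import structures.
From mathcomp Require Export all_boot all_order all_algebra.
From mathcomp Require Export boolp classical_sets.

Set Implicit Arguments.
Unset Strict Implicit.
Unset Printing Implicit Defensive.

Import GRing.Theory.
Local Open Scope ring_scope.
Local Open Scope classical_set_scope.

(* The ideals of ring_quotient are decidable and proper, and live over
   nontrivial rings. Here an ideal is any subset closed under the ideal
   operations: [set: R] is one, and R may be the zero ring. *)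
Definition is_ideal (R : comPzRingType) (I : set R) : Prop :=
  [/\ I 0,
      forall x y, I x -> I y -> I (x + y) &
      forall a x, I x -> I (a * x)].

Record ideal (R : comPzRingType) := Ideal {
  ideal_set :> set R;
  idealP : is_ideal ideal_set }.

Definition Spec (R : comPzRingType) : set (set R) :=
  [set P | [/\ is_ideal P, P <> [set: R] &
               forall x y, P (x * y) -> P x \/ P y]].

Definition Max (R : comPzRingType) : set (set R) :=
  [set M | [/\ is_ideal M, M <> [set: R] &
               forall I, is_ideal I -> M `<=` I -> I = M \/ I = [set: R]]].

Arguments Spec R : clear implicits.
Arguments Max R : clear implicits.

(* Equal to [set: R] when R is the zero ring (empty intersection). *)
Definition Jac (R : comPzRingType) : set R := \bigcap_(M in Max R) M.

Arguments Jac R : clear implicits.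

Definition V (R : comPzRingType) (I : set R) : set (set R) :=
  [set P | Spec R P /\ I `<=` P].

Definition is_local (R : comPzRingType) : Prop := exists! M, Max R M.

Section Amalgamation.
Variables (A B : comPzRingType) (f : {rmorphism A -> B}) (J : ideal B).

Definition amalg_set : set (A * B) :=
  [set (a, f a + j) | a in [set: A] & j in ideal_set J].

Definition amalg_pred : {pred A * B} := [pred x | x \in amalg_set].

Lemma amalg_subring : subring_closed amalg_pred.
Proof.
have [J0 JD JM] := idealP J.
have JN x : ideal_set J x -> ideal_set J (- x).
  by move=> Jx; rewrite -mulN1r; apply: JM.
split=> [|_ _ /set_mem[a _ [i Ji <-]] /set_mem[b _ [j Jj <-]]
         |_ _ /set_mem[a _ [i Ji <-]] /set_mem[b _ [j Jj <-]]]; apply/mem_set.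
- by exists 1 => //; exists 0 => //; rewrite rmorph1 addr0.
- exists (a - b) => //; exists (i - j); first by apply: JD => //; apply: JN.
  by rewrite rmorphB addrACA -opprD.
- exists (a * b) => //; exists (f a * j + i * f b + i * j).
    by apply: (JD); [apply: JD; [|rewrite mulrC] |]; apply: JM.
  by rewrite rmorphM -!addrA -mulrDr addrA -mulrDr -mulrDl.
Qed.

HB.instance Definition _ :=
  GRing.isSubringClosed.Build (A * B)%type amalg_pred amalg_subring.

Record amalg := Amalg { amalg_val : A * B; _ : amalg_val \in amalg_pred }.

HB.instance Definition _ := [isSub for amalg_val].
HB.instance Definition _ := [Choice of amalg by <:].
HB.instance Definition _ :=
  GRing.SubChoice_isSubComPzRing.Build (A * B)%type amalg_pred amalg
    amalg_subring.

(* P'^f and \overline{Q}^f, as subsets of the ring amalg f J rather than of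
   A * B. *)
Definition prime_up (P : set A) : set amalg :=
  [set x | exists p j, [/\ P p, ideal_set J j & val x = (p, f p + j)]].

Definition prime_bar (Q : set B) : set amalg :=
  [set x | exists a j, [/\ ideal_set J j, Q (f a + j) & val x = (a, f a + j)]].

End Amalgamation.

Arguments prime_up [A B] f J P _.
Arguments prime_bar [A B] f J Q _.

(* Main.v *)
Require Import Defs.
From mathcomp Require Import ring.
Import GRing.Theory.
Local Open Scope ring_scope.
Local Open Scope classical_set_scope.

(** Both families of ideals are preimages: [prime_up f J P] and
    [prime_bar f J Q] pull [P] and [Q] back along the projections of the
    amalgam to [A] and to [B] ([prime_upE], [prime_barE]). Throughout,
    maximality is used in the elementwise form of [MaxP]: a proper ideal is
    maximal iff every element outside it is invertible modulo it.

    The projection to [A] is onto, and maximality passes both ways along a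
    surjection ([Max_preimage_surj]); this is part (1). The projection to [B]
    is usually not onto, but its image contains [J]. When [Q] is prime and
    some [j0] in [J] lies outside [Q], the multiplier [j0] carries any [b]
    outside [Q] to an element [b * j0] of [J] that is still outside [Q] and
    lifts to [(0, b * j0)]; hence inverses modulo [Q] and modulo its preimage
    can be traded for each other ([Max_prime_bar]).

    To see that no other maximal ideal exists, let [M] be one and look at the
    kernel [{(0, j)}] of the projection to [A]. If [M] contains it, then [M] is
    the preimage of its image in [A] ([Max_above_kernel]). Otherwise some
    [(0, j0)] is not in [M], and [M] is the preimage of the conductor
    [{b | (0, b * j0) \in M}], which is maximal in [B] and misses [j0]
    ([Max_off_kernel]).

    For part (3), the second family is empty exactly when [J] lies in every
    maximal ideal of [B], and [P |-> prime_up f J P] is injective. If the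
    amalgam is local, then [A] is nonzero, so Krull's theorem ([Max_exists])
    provides a maximal ideal of [A]; its preimage must be the only maximal
    ideal of the amalgam. *)

(** * Maximal ideals of commutative rings *)

Lemma ideal_properP {R : comPzRingType} {I : set R} :
  is_ideal I -> (I <> [set: R] <-> ~ I 1).
Proof.
move=> [_ _ IM]; split=> [In I1|I1 eqI]; last by apply: I1; rewrite eqI.
by apply: In; apply/seteqP; split=> // x _; rewrite -[x]mulr1; apply: IM.
Qed.

Lemma MaxP {R : comPzRingType} {M : set R} :
  Max R M <-> [/\ is_ideal M, ~ M 1 &
                  forall x, ~ M x -> exists y, M (1 - x * y)].
Proof.
split=> [[idM /(ideal_properP idM) M1 maxM]|[idM M1 invM]].
  split=> // x Mx; have [M0 MD MM] := idM.
  (* The ideal generated by M and x. *)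
  pose I := [set z | exists y, M (z - x * y)].
  have idI : is_ideal I.
    split=> [|u v [y Iu] [z Iv]|a u [y Iu]].
    - by exists 0; rewrite mulr0 subr0.
    - exists (y + z); have -> : u + v - x * (y + z) = (u - x * y) + (v - x * z).
        by ring.
      exact: MD.
    - exists (a * y); have -> : a * u - x * (a * y) = a * (u - x * y) by ring.
      exact: MM.
  have MI : M `<=` I by move=> z Mz; exists 0; rewrite mulr0 subr0.
  have Ix : I x by exists 1; rewrite mulr1 subrr.
  have [eqI|IT] := maxM I idI MI; first by case: Mx; rewrite -eqI.
  by have : I 1 by rewrite IT.
split=> //; first exact/ideal_properP.
move=> I idI MI; have [_ ID IM] := idI.
have [IsubM|/existsNP[x /not_implyP[Ix Mx]]] := pselect (I `<=` M).
  by left; apply/seteqP.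
right; have [y Mxy] := invM x Mx.
apply/seteqP; split=> // z _; rewrite -[z]mulr1; apply: (IM).
have -> : 1 = (1 - x * y) + y * x by ring.
by apply: ID; [exact: MI|exact: IM].
Qed.

Lemma Max_Spec {R : comPzRingType} {M : set R} : Max R M -> Spec R M.
Proof.
move=> /MaxP[idM M1 invM]; have [_ MD MM] := idM; split=> //.
  exact/ideal_properP.
move=> x y Mxy; have [Mx|/invM[z Mz]] := pselect (M x); first by left.
right; have -> : y = y * (1 - x * z) + z * (x * y) by ring.
by apply: MD; apply: MM.
Qed.

(** Krull's theorem, by Zorn's lemma. The sets fed to Zorn are not required to
    contain [0], so that the union of the empty chain qualifies; a maximal one
    is nonempty, because otherwise [{0}] would be larger. *)
Lemma Max_exists {R : comPzRingType} : (1 : R) <> 0 -> exists M, Max R M.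
Proof.
move=> R1.
pose proper (I : set R) :=
  [/\ ~ I 1, forall x y, I x -> I y -> I (x + y) & forall a x, I x -> I (a * x)].
have [F Fproper Fchain|M [[M1 MD MM] maxM]] := @Zorn_bigcup R proper.
  split=> [[I FI]|x y [I FI Ix] [K FK Ky]|a x [I FI Ix]].
  - by have [] := Fproper I FI.
  - have [/(_ _ Ix) Kx|/(_ _ Ky) Iy] := Fchain I K FI FK.
      by exists K => //; have [_ KD _] := Fproper K FK; exact: KD.
    by exists I => //; have [_ ID _] := Fproper I FI; exact: ID.
  - by exists I => //; have [_ _ IM] := Fproper I FI; exact: IM.
have notlarger I : M `<=` I -> proper I -> I = M.
  move=> MI propI; apply/seteqP; split=> //; apply: contrapT => IM.
  by apply: (maxM I) => //; split.
have M0 : M 0.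
  apply: contrapT => M0; apply: (M0); rewrite -(notlarger [set 0]) //.
    by move=> x Mx; case: M0; rewrite -(mul0r x); apply: MM.
  split=> [/R1//|x y -> ->|a x ->]; first by rewrite /= addr0.
  by rewrite /= mulr0.
have idM : is_ideal M by [].
exists M; split=> //; first exact/ideal_properP.
move=> I idI MI; have [I1|I1] := pselect (I 1).
  by right; apply: contrapT => /(ideal_properP idI).
by left; apply: notlarger => //; have [_ ID IM] := idI.
Qed.

(** * Preimages of ideals *)

Lemma in_preimageE {T U : Type} (g : T -> U) (I : set U) (x : T) :
  (g @^-1` I) x = I (g x).
Proof. by []. Qed.

Lemma preimage_ideal {R S : comPzRingType} (g : {rmorphism R -> S})
    {I : set S} : is_ideal I -> is_ideal (g @^-1` I).
Proof.
move=> [I0 ID IM]; split=> [|x y|a x] /=.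
- by rewrite rmorph0.
- by rewrite rmorphD; exact: ID.
- by rewrite rmorphM; exact: IM.
Qed.

Lemma Max_preimage_surj {R S : comPzRingType} (g : {rmorphism R -> S})
    {I : set S} : (forall s, exists r, g r = s) -> is_ideal I ->
  (Max R (g @^-1` I) <-> Max S I).
Proof.
move=> gsurj idI; split=> /MaxP[_ I1 invI]; apply/MaxP; split=> //.
- by move: I1; rewrite /= rmorph1.
- move=> s; have [r <-] := gsurj s => /invI[y].
  by rewrite /= rmorphB rmorphM rmorph1; exists (g y).
- exact: preimage_ideal.
- by rewrite /= rmorph1.
move=> r /invI[s]; have [y <-] := gsurj s => Iy.
by exists y; rewrite /= rmorphB rmorphM rmorph1.
Qed.

(** * The two projections of an amalgam *)

Definition projA {A B : comPzRingType} (f : {rmorphism A -> B}) (J : ideal B) :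
  {rmorphism amalg f J -> A} := @fst A B \o \val.

Definition projB {A B : comPzRingType} (f : {rmorphism A -> B}) (J : ideal B) :
  {rmorphism amalg f J -> B} := @snd A B \o \val.

Section Amalgam.
Context {A B : comPzRingType} {f : {rmorphism A -> B}} {J : ideal B}.

Local Notation pA := (projA f J).
Local Notation pB := (projB f J).

Lemma amalgP (x : amalg f J) : ideal_set J (pB x - f (pA x)).
Proof.
have /set_mem[a _ [j Jj def_x]] := valP x.
by rewrite /= -def_x /= addrC addKr.
Qed.

Lemma amalg_lift (a : A) (b : B) :
  ideal_set J (b - f a) -> exists x : amalg f J, pA x = a /\ pB x = b.
Proof.
move=> Jb; have xP : (a, b) \in amalg_pred f J.
  by apply/mem_set; exists a => //; exists (b - f a); rewrite // addrC subrK.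
by exists (Amalg xP).
Qed.

Lemma kernel_lift (j : B) : ideal_set J j -> exists x : amalg f J, pA x = 0 /\ pB x = j.
Proof. by move=> Jj; apply: amalg_lift; rewrite rmorph0 subr0. Qed.

Lemma amalg_inj (x y : amalg f J) : pA x = pA y -> pB x = pB y -> x = y.
Proof.
move=> /= eqA eqB; apply: val_inj.
by rewrite [LHS]surjective_pairing [RHS]surjective_pairing eqA eqB.
Qed.

Lemma projA_surj (a : A) : exists x : amalg f J, pA x = a.
Proof.
have [|x [xA _]] := amalg_lift a (f a); last by exists x.
by rewrite subrr; have [] := idealP J.
Qed.

Lemma prime_upE (P : set A) : prime_up f J P = pA @^-1` P.
Proof.
apply/seteqP; split=> x /=; first by move=> [p [j [Pp _ ->]]].
move=> Px; exists (pA x), (pB x - f (pA x)); split=> //; first exact: amalgP.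
by rewrite addrC subrK [LHS]surjective_pairing.
Qed.

Lemma prime_barE (Q : set B) : prime_bar f J Q = pB @^-1` Q.
Proof.
apply/seteqP; split=> x /=; first by move=> [a [j [_ Qj ->]]].
move=> Qx; exists (pA x), (pB x - f (pA x)).
split; first exact: amalgP.
  by rewrite addrC subrK.
by rewrite addrC subrK [LHS]surjective_pairing.
Qed.

Lemma prime_up_inj (P P' : set A) :
  prime_up f J P = prime_up f J P' -> P = P'.
Proof.
rewrite !prime_upE => eqP; rewrite predeqE => a.
have [x <-] := projA_surj a.
by have /= := congr1 (fun S : set (amalg f J) => S x) eqP => ->.
Qed.

(** * Maximality in the two families *)

Lemma Max_prime_up (P : set A) :
  is_ideal P -> (Max (amalg f J) (prime_up f J P) <-> Max A P).
Proof. by rewrite prime_upE; apply: Max_preimage_surj; exact: projA_surj. Qed.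

(** Multiplying by an element [j0] of [J] outside [Q] brings elements of [B]
    into the image of the amalgam: [j0 * c] always lifts to the kernel of the
    projection to [A]. *)
Lemma Max_prime_bar (Q : set B) : Spec B Q -> ~ J `<=` Q ->
  (Max (amalg f J) (prime_bar f J Q) <-> Max B Q).
Proof.
move=> [idQ /(ideal_properP idQ) Q1 Qprime].
move=> /existsNP[j0 /not_implyP[Jj0 Qj0]].
have [_ _ JM] := idealP J.
have Qbj0 b : ~ Q b -> ~ Q (b * j0) by move=> Qb /Qprime[].
rewrite prime_barE; split=> /MaxP[_ _ invQ]; apply/MaxP; split=> //.
- move=> b Qb; have [x [_ xB]] := kernel_lift (b * j0) (JM b j0 Jj0).
  have [|y] := invQ x; first by rewrite in_preimageE xB; exact: Qbj0.
  rewrite in_preimageE rmorphB rmorphM rmorph1 xB -mulrA => Qy.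
  by exists (j0 * pB y).
- exact: preimage_ideal.
move=> x /Qbj0/invQ[c Qc].
have [y [_ yB]] := kernel_lift (c * j0) (JM c j0 Jj0).
exists y; rewrite in_preimageE rmorphB rmorphM rmorph1 yB.
by rewrite (mulrC c) mulrA.
Qed.

(** * Every maximal ideal of the amalgam is in one of the families *)

(** An ideal containing the kernel is a union of its cosets, so [M] is the full
    preimage of its image [P] in [A]. *)
Lemma Max_above_kernel (M : set (amalg f J)) :
  Max (amalg f J) M -> (forall x, pA x = 0 -> M x) ->
  exists2 P, Max A P & prime_up f J P = M.
Proof.
move=> maxM kerM; have [idM _ _] := maxM; have [M0 MD MM] := idM.
pose P := [set a | exists2 x, M x & pA x = a].
have eqM : prime_up f J P = M.
  rewrite prime_upE; apply/seteqP; split=> x; last by exists x.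
  move=> [y My eqA]; rewrite -[x](subrK y); apply: MD => //.
  by apply: kerM; rewrite rmorphB eqA subrr.
exists P => //; apply/Max_prime_up; last by rewrite eqM.
split=> [|a b [x Mx <-] [y My <-]|c a [x Mx <-]].
- by exists 0; rewrite ?rmorph0.
- by exists (x + y); [exact: MD|rewrite rmorphD].
have [z <-] := projA_surj c.
by exists (z * x); [exact: MM|rewrite rmorphM].
Qed.

(** Write [e = (0, j0)]. Any [b] in [B] gives an element [(0, b * j0)] of the
    amalgam, and for [b] the second component of an element [x] this is [x * e].
    As [M] is prime and [e] lies outside it, [x * e] is in [M] only if [x] is:
    the conductor [Q] below therefore pulls back to [M]. *)
Lemma Max_off_kernel (M : set (amalg f J)) (e : amalg f J) :
  Max (amalg f J) M -> pA e = 0 -> ~ M e ->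
  exists2 Q, (Max B `\` V J) Q & prime_bar f J Q = M.
Proof.
move=> maxM eA Me.
have [idM /(ideal_properP idM) M1 Mprime] := Max_Spec maxM.
have [_ _ invM] := (MaxP.1 maxM); have [M0 MD MM] := idM.
have Je : ideal_set J (pB e) by have := amalgP e; rewrite eA rmorph0 subr0.
have [_ _ JM] := idealP J.
pose Q := [set b | exists x, [/\ M x, pA x = 0 & pB x = b * pB e]].
have idQ : is_ideal Q.
  split=> [|b c [x [Mx xA xB]] [y [My yA yB]]|c b [x [Mx xA xB]]].
  - by exists 0; rewrite !rmorph0 mul0r.
  - exists (x + y); split; first exact: MD.
      by rewrite rmorphD xA yA addr0.
    by rewrite rmorphD xB yB mulrDl.
  (* c itself need not lift to the amalgam, but c * j0 does: (0, c * b * j0) is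
     in M because its product with e is a multiple of x. *)
  have [y [yA yB]] := kernel_lift (c * b * pB e) (JM (c * b) _ Je).
  exists y; split=> //.
  have [z [zA zB]] := kernel_lift (c * pB e) (JM c _ Je).
  have eqM : y * e = z * x.
    by apply: amalg_inj; rewrite !rmorphM ?yA ?zA ?mul0r // yB zB xB; ring.
  by have [|//|//] := Mprime y e; rewrite eqM; exact: MM.
have eqM : prime_bar f J Q = M.
  rewrite prime_barE; apply/seteqP; split=> x /=.
    move=> [y [My yA yB]].
    have eqM : y = x * e by apply: amalg_inj; rewrite rmorphM // yA eA mulr0.
    by have [|//|//] := Mprime x e; rewrite -eqM.
  move=> Mx; exists (x * e); split; last by rewrite rmorphM.
    by rewrite mulrC; exact: MM.
  by rewrite rmorphM eA mulr0.
have Qe : ~ Q (pB e).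
  by move=> Qe; apply: Me; rewrite -eqM prime_barE.
exists Q => //; split; last by move=> [_ /(_ _ Je)].
apply/MaxP; split=> // [Q1|b Qb].
  by apply: M1; rewrite -eqM prime_barE in_preimageE rmorph1.
have [x [xA xB]] := kernel_lift (b * pB e) (JM b _ Je).
have [|y] := invM x; first by move=> Mx; apply: Qb; exists x.
rewrite -{1}eqM prime_barE in_preimageE rmorphB rmorphM rmorph1 xB -mulrA.
by exists (pB e * pB y).
Qed.

Lemma Max_amalg : Max (amalg f J) =
  [set prime_up f J P | P in Max A] `|`
  [set prime_bar f J Q | Q in Max B `\` V J].
Proof.
apply/seteqP; split=> [M maxM|M [[P maxP <-]|[Q [maxQ VQ] <-]]].
- have [kerM|/existsNP[e /not_implyP[eA Me]]] :=
    pselect (forall x, pA x = 0 -> M x).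
    by left; exact: Max_above_kernel.
  by right; exact: Max_off_kernel eA Me.
- by have [idP _ _] := maxP; apply/Max_prime_up.
have SQ := Max_Spec maxQ.
by apply/Max_prime_bar => // JQ; apply: VQ.
Qed.

(** * Local amalgams *)

Lemma Max_amalg_sub_Jac : J `<=` Jac B ->
  Max (amalg f J) = [set prime_up f J P | P in Max A].
Proof.
move=> JJac; rewrite Max_amalg; apply/seteqP; split=> M; last by left.
case=> // -[Q [maxQ VQ] _]; case: VQ; split; first exact: Max_Spec.
by move=> j /JJac; apply.
Qed.

(** An ideal [prime_up f J P] contains the kernel [{(0, j)}], whereas
    [prime_bar f J Q] does so only if [Q] contains [J]. *)
Lemma local_amalg_sub_Jac :
  is_local (amalg f J) -> is_local A /\ J `<=` Jac B.
Proof.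
move=> [M [maxM uniqM]].
have [P maxP] : exists P, Max A P.
  (* If 1 = 0 in A, then also in B, hence in the amalgam. *)
  apply: Max_exists => A1; have /MaxP[[M0 _ _] M1 _] := maxM; apply: M1.
  have -> // : 1 = 0 :> amalg f J.
  apply: amalg_inj; rewrite !rmorph1 !rmorph0 //.
  by rewrite -(rmorph1 f) A1 rmorph0.
have up_M P' : Max A P' -> prime_up f J P' = M.
  move=> maxP'; apply/esym/uniqM; have [idP' _ _] := maxP'.
  exact/Max_prime_up.
split.
  exists P; split=> // P' maxP'.
  by apply: prime_up_inj; rewrite !up_M.
move=> j Jj Q maxQ; apply: contrapT => Qj.
have barQ : prime_bar f J Q = prime_up f J P.
  rewrite (up_M P) //; apply/esym/uniqM/Max_prime_bar => //.
    exact: Max_Spec.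
  by move=> /(_ _ Jj).
have [x [xA xB]] := kernel_lift j Jj.
apply: Qj; rewrite -xB -[Q _]/((pB @^-1` Q) x) -prime_barE barQ prime_upE.
by rewrite in_preimageE xA; have [[P0 _ _] _ _] := maxP.
Qed.

End Amalgam.

Theorem corollary2p7 (A B : comPzRingType) (f : {rmorphism A -> B})
    (J : ideal B) :
  (forall P : set A, Spec A P ->
     (Max (amalg f J) (prime_up f J P) <-> Max A P)) /\
  ((forall Q : set B, Spec B Q -> ~ (J `<=` Q) ->
      (Max (amalg f J) (prime_bar f J Q) <-> Max B Q)) /\
   Max (amalg f J) =
     [set prime_up f J P | P in Max A] `|`
     [set prime_bar f J Q | Q in Max B `\` V J]) /\
  ((is_local (amalg f J) <-> is_local A /\ J `<=` Jac B) /\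
   (is_local (amalg f J) ->
      forall M : set A, Max A = [set M] ->
        Max (amalg f J) = [set prime_up f J M])).
Proof.
split; first by move=> P [idP _ _]; exact: Max_prime_up.
split; first by split; [exact: Max_prime_bar|exact: Max_amalg].
split; last first.
  move=> /local_amalg_sub_Jac[_ /Max_amalg_sub_Jac ->] M ->.
  exact: image_set1.
split; first exact: local_amalg_sub_Jac.
move=> [[M [maxM uniqM]] /Max_amalg_sub_Jac MaxE].
exists (prime_up f J M); rewrite MaxE; split; first by exists M.
by move=> _ [P maxP <-]; rewrite (uniqM P).
Qed.
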